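(* Let $1\le\alpha<\infty$ and let $\varphi,\psi\colon[0,1]\to[0,+\infty)$ be continuous functions. Set $f(x)=x^{\alpha}\varphi(x)$ and $g(x)=x^{\alpha}\psi(x)$ $(x\in[0,1])$ and suppose that $f,g$ are bounded and that $\mathbf{E}_f$ and $\mathbf{E}_g$ are equivalence relations. Suppose $\psi(x)>0$ for every $x>0$, and (A1) there exist $\varepsilon>0$ and $M<\omega$ such that for every integer $n>M$ and all $x,y\in[0,1]$, $$\varphi(x)\le\varepsilon\,\varphi(y)\,\varphi(1/2^{n})\ \Rightarrow\ x\le\frac{y}{2^{n+1}};$$ (A2) $\lim_{n\to\infty}\psi(1/2^{n})/\varphi(1/2^{n})=0$. Then $\mathbf{E}_g\not\le_B\mathbf{E}_f$.
   Context: For $f\colon[0,1]\to[0,\infty)$, $\mathbf{E}_f$ is the relation on $[0,1]^{\omega}$ given by $(x_n)\,\mathbf{E}_f\,(y_n)\iff\sum_{n<\omega}f(|y_n-x_n|)<\infty$. For equivalence relations $E$ on a Polish space $X$ and $F$ on a Polish space $Y$, $E\le_B F$ means there is a Borel function $\vartheta\colon X\to Y$ with $x\,E\,x'\iff\vartheta(x)\,F\,\vartheta(x')$ for all $x,x'\in X$. *)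

(* Defs.v *)
From mathcomp Require Import all_boot all_order all_algebra.
From mathcomp Require Import all_classical all_reals all_analysis.
From Corelib Require RelationClasses.

Set Implicit Arguments.
Unset Strict Implicit.
Unset Printing Implicit Defensive.

Import Order.TTheory GRing.Theory Num.Theory.
Import numFieldNormedType.Exports.

Local Open Scope classical_set_scope.
Local Open Scope ring_scope.

(* The compact Polish space [0,1]^omega, with the product topology.  The factor
   is the subtype [0,1] of R with its induced topology, so that points of the
   cube are genuine sequences in [0,1]. *)
Definition hilbert_cube (R : realType) : topologicalType :=
  prod_topology (fun _ : nat => set_type (`[0, 1]%classic : set R)).

(* f is total on R, but only its values on [0,1] are used.  For f nonnegative on
   [0,1], the sum always exists in [0, +oo]. *)
Definition sum_rel (R : realType) (f : R -> R) (x y : hilbert_cube R) : Prop :=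
  (\sum_(0 <= n <oo) (f `|set_val (y n) - set_val (x n)|)%:E < +oo)%E.

Definition borel_set (X : topologicalType) : set (set X) :=
  <<s [set U : set X | open U] >>.

Definition borel_fun (X Y : topologicalType) (theta : X -> Y) : Prop :=
  forall B : set Y, borel_set B -> borel_set (theta @^-1` B).

(* Meant for Polish X, Y and equivalence relations E, F. *)
Definition borel_reducible (X Y : topologicalType)
    (E : X -> X -> Prop) (F : Y -> Y -> Prop) : Prop :=
  exists theta : X -> Y, borel_fun theta /\
    forall x x' : X, E x x' <-> F (theta x) (theta x').

(* Main.v *)
(* Suppose theta reduces E_g to E_f.  On the points of the cube whose i-th
   coordinate is a multiple of 2^-i, theta agrees on a comeager set with a
   continuous map, and altering finitely many coordinates changes theta by an
   f-summable amount, which Baire category makes uniform.  Filling all but a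
   sparse set L_0 < L_1 < ... of coordinates with a sufficiently generic
   sequence then makes theta additive up to an f-summable error: the sum over a
   block [N_j, N_(j+1)) of output coordinates depends only on the input at L_j.

   Let W_j(s, t) be the f-distance between the j-th blocks of the inputs s and t.
   If W_j(0, 1) is small for infinitely many j, a subsequence makes the constant
   inputs 0 and 1 equivalent, which is absurd since g(1) > 0.  Otherwise
   W_j(0, 1) >= c for infinitely many j, and by (A1), among the 2^m steps of
   length 2^-m from 0 to 1 one has W_j of order at least c f(2^-m), whereas its
   cost in the domain is g(2^-m), which is o(f(2^-m)) by (A2).  Repeating such
   steps suitably often makes the g-sum converge and the f-sum diverge. *)
Require Import Defs.
From mathcomp Require Import all_boot all_order all_algebra.
From mathcomp Require Import all_classical all_reals all_analysis.
From mathcomp Require Import ring lra.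
Import Order.TTheory GRing.Theory Num.Theory.
Import numFieldNormedType.Exports.
Local Open Scope classical_set_scope.
Local Open Scope ring_scope.

Set Implicit Arguments.
Unset Strict Implicit.
Unset Printing Implicit Defensive.

(** For nonnegative terms this is convergence of the series, stated without limits or extended
    reals. *)
Definition bounded_sums (R : realType) (u : nat -> R) :=
  exists B : R, forall N, \sum_(0 <= n < N) u n <= B.

(** * Series with bounded partial sums: blocks, sparse supports, tails *)

Section real_sums.
Context {R : realType}.
Implicit Types u v : nat -> R.

Lemma sum_nat_le u M N : (forall n, 0 <= u n) -> (M <= N)%N ->
  \sum_(0 <= n < M) u n <= \sum_(0 <= n < N) u n.
Proof.
by move=> u0 MN; rewrite [leRHS](big_cat_nat (leq0n M) MN) /= lerDl sumr_ge0.
Qed.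

Lemma strict_leq_id (L : nat -> nat) : (forall j, (L j < L j.+1)%N) ->
  forall j, (j <= L j)%N.
Proof. by move=> Ll; elim=> // j IH; apply: leq_ltn_trans IH (Ll j). Qed.

Lemma strict_leq (L : nat -> nat) : (forall j, (L j < L j.+1)%N) ->
  forall i j, (i <= j)%N -> (L i <= L j)%N.
Proof. by move=> Ll; apply: (homo_leq leqnn leq_trans) => i; apply: ltnW. Qed.

Lemma strict_lt (L : nat -> nat) : (forall j, (L j < L j.+1)%N) ->
  forall i j, (i < j)%N -> (L i < L j)%N.
Proof.
by move=> Ll i j ij; apply: leq_trans (Ll i) _; apply: strict_leq.
Qed.

Lemma strict_inj (L : nat -> nat) : (forall j, (L j < L j.+1)%N) -> injective L.
Proof.
move=> Ll i j ij; apply/eqP; rewrite eqn_leq.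
by apply/andP; split; rewrite leqNgt; apply/negP => /(strict_lt Ll);
  rewrite ij ltnn.
Qed.

Lemma sum_blocks u (N : nat -> nat) J :
  N 0%N = 0%N -> (forall j, (N j < N j.+1)%N) ->
  \sum_(0 <= n < N J) u n =
  \sum_(0 <= j < J) \sum_(N j <= n < N j.+1) u n.
Proof.
move=> N0 Nl; elim: J => [|J IH]; first by rewrite N0 !big_geq.
by rewrite big_nat_recr //= -IH -big_cat_nat //= ltnW.
Qed.

Lemma bounded_sums_blocks u (N : nat -> nat) : (forall n, 0 <= u n) ->
  N 0%N = 0%N -> (forall j, (N j < N j.+1)%N) ->
  bounded_sums u <-> bounded_sums (fun j => \sum_(N j <= n < N j.+1) u n).
Proof.
move=> u0 N0 Nl; split=> -[B uB]; exists B => J.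
  by rewrite -sum_blocks.
apply: le_trans (uB J); rewrite -sum_blocks //; apply: sum_nat_le => //.
exact: strict_leq_id.
Qed.

Lemma bounded_sums_geometric u : (forall n, u n <= 2 ^- n) -> bounded_sums u.
Proof.
move=> u2; exists 2 => N.
(* The bound is sharpened to the exact value of the geometric sum so that the induction closes. *)
suff : \sum_(0 <= n < N) u n <= 2 - 2 * 2 ^- N.
  by move/le_trans; apply; rewrite gerBl mulr_ge0 // invr_ge0 exprn_ge0.
elim: N => [|N IH]; first by rewrite big_geq // expr0 invr1 mulr1 subrr.
rewrite big_nat_recr //= exprS invfM.
by move: IH (u2 N); set s := \sum_(_ <= _ < _) _; set t := 2 ^- N; lra.
Qed.

Lemma bounded_sums_sparse u (L : nat -> nat) : (forall n, 0 <= u n) ->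
  (forall j, (L j < L j.+1)%N) -> (forall n, (forall j, n <> L j) -> u n = 0) ->
  bounded_sums u <-> bounded_sums (fun j => u (L j)).
Proof.
move=> u0 Ll uL0.
have E J : \sum_(0 <= n < L J) u n = \sum_(0 <= j < J) u (L j).
  elim: J => [|J IH].
    rewrite [RHS]big_geq // big_nat big1 // => n /andP[_ nL]; apply: uL0 => j nj.
    by move: nL; rewrite nj ltnNge (strict_leq Ll).
  rewrite big_nat_recr //= -IH.
  rewrite (big_cat_nat (leq0n (L J)) (ltnW (Ll J))) /=; congr (_ + _).
  rewrite big_ltn // big_nat big1 ?addr0 // => n /andP[Jn nJ].
  apply: uL0 => j nj; move: Jn nJ; rewrite nj.
  case: (ltngtP j J) => [jJ|jJ|->]; last by rewrite ltnn.
    by move=> h; have := strict_lt Ll jJ; rewrite ltnNge ltnW.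
  by move=> _; rewrite ltnNge (strict_leq Ll).
split=> -[B uB]; exists B => J; first by rewrite -E.
apply: le_trans (uB J); rewrite -E; apply: sum_nat_le => //.
exact: strict_leq_id.
Qed.

Lemma bounded_sums_le u v : (forall n, u n <= v n) ->
  bounded_sums v -> bounded_sums u.
Proof.
by move=> uv [B vB]; exists B => N; apply: le_trans (vB N); apply: ler_sum.
Qed.

Lemma eq_bounded_sums u v : u =1 v -> bounded_sums u <-> bounded_sums v.
Proof. by move=> /funext ->. Qed.

(** Serves to assemble sequences whose [n]-th entry depends on the block containing [n]. *)
Lemma block_index (N : nat -> nat) : N 0%N = 0%N -> (forall j, (N j < N j.+1)%N) ->
  exists jn : nat -> nat, forall n j, (N j <= n < N j.+1)%N -> jn n = j.
Proof.
move=> N0 Nl; suff /choice[jn jnP] : forall n, exists j, (N j <= n < N j.+1)%N.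
  exists jn => n j /andP[jn1 nj]; have /andP[jn2 nj2] := jnP n.
  apply/eqP; rewrite eqn_leq; apply/andP; split; rewrite leqNgt; apply/negP.
    by move=> /(strict_leq Nl); rewrite leqNgt (leq_ltn_trans jn2 nj).
  by move=> /(strict_leq Nl); rewrite leqNgt (leq_ltn_trans jn1 nj2).
elim=> [|n [j /andP[jn nj]]]; first by exists 0%N; rewrite N0 -{3}N0 Nl.
have [h|h] := ltnP n.+1 (N j.+1); first by exists j; rewrite h (leq_trans jn).
by exists j.+1; rewrite h /=; apply: leq_ltn_trans (Nl j.+1).
Qed.

(** Otherwise windows of sum above [delta] occur arbitrarily far out, and stacking [k] disjoint ones
    gives partial sums of at least [k * delta]. *)
Lemma bounded_sums_tail u (delta : R) :
  (forall n, 0 <= u n) -> 0 < delta ->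
  bounded_sums u ->
  exists l, forall N N', (l <= N)%N -> \sum_(N <= n < N') u n <= delta.
Proof.
move=> u0 d0 [B uB]; apply: contrapT => /forallNP nl.
have {}nl l : exists N, exists N', (l <= N)%N /\ delta < \sum_(N <= n < N') u n.
  have /existsNP[N /existsNP[N' /not_implyP[lN /negP]]] := nl l.
  by rewrite -ltNge => dN; exists N, N'.
have grow k : exists l, delta *+ k <= \sum_(0 <= n < l) u n.
  elim: k => [|k [l kl]]; first by exists 0%N; rewrite big_geq.
  have [N [N' [lN dN]]] := nl l; exists N'.
  have NN : (N <= N')%N.
    by rewrite leqNgt; apply/negP => /ltnW h; move: dN; rewrite big_geq // ltNge ltW.
  rewrite (big_cat_nat (leq0n N) NN) /= (big_cat_nat (leq0n l) lN) /=.
  have : 0 <= \sum_(l <= n < N) u n by apply: sumr_ge0.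
  by rewrite mulrS; lra.
have [l] := grow (Num.bound (B / delta)); rewrite leNgt => /negP; apply.
apply: (le_lt_trans (uB l)); rewrite -mulr_natr mulrC -ltr_pdivrMr //.
apply: le_lt_trans (archi_boundP _); first by [].
by rewrite divr_ge0 ?(ltW d0) //; have := uB 0%N; rewrite big_geq.
Qed.

Lemma itv01_dist (a b : R) : 0 <= a <= 1 -> 0 <= b <= 1 -> 0 <= `|b - a| <= 1.
Proof.
move=> /andP[a0 a1] /andP[b0 b1].
by rewrite normr_ge0 ler_norml; apply/andP; split; lra.
Qed.

Lemma itv01_half_pow m : 0 < (1 / 2 ^+ m : R) <= 1.
Proof.
by rewrite div1r invr_gt0 exprn_gt0 //= invf_le1 ?exprn_gt0 // exprn_ege1 // ler1n.
Qed.

Lemma itv01_half_powW m : 0 <= (1 / 2 ^+ m : R) <= 1.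
Proof. by have /andP[/ltW -> ->] := itv01_half_pow m. Qed.

End real_sums.


(** * Baire category in a product of discrete spaces *)

Section category.
Context {A : nat -> Type}.
Local Notation pt := (forall i, A i).
Implicit Types (x y : pt) (U : set pt) (D : nat -> set pt).

Definition agree (L : nat) x y := forall i, (i < L)%N -> x i = y i.

Definition splice (L : nat) x y : pt := fun i => if (i < L)%N then x i else y i.

(** Cylinders, given by [agree], are the basic open sets of the product of the discrete spaces
    [A i]; this is openness there. *)
Definition seq_open U := forall x, U x -> exists L, forall y, agree L x y -> U y.

(** In terms of cylinders, [U] contains a dense open set, so countable intersections of such sets
    are comeager. *)
Definition dense_interior U := forall x L,
  exists y M, agree L x y /\ forall z, agree M y z -> U z.

Lemma agree_trans L x y z : agree L x y -> agree L y z -> agree L x z.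
Proof. by move=> xy yz i iL; rewrite xy ?yz. Qed.

Lemma agree_leq L L' x y : (L <= L')%N -> agree L' x y -> agree L x y.
Proof. by move=> LL xy i iL; apply: xy; apply: leq_trans LL. Qed.

Lemma agree_splice L x y : agree L x (splice L x y).
Proof. by move=> i iL; rewrite /splice iL. Qed.

Lemma agree_splice2 L L' x y y' :
  agree L' y y' -> agree L' (splice L x y) (splice L x y').
Proof. by move=> yy i iL; rewrite /splice; case: ifP => // _; apply: yy. Qed.

Lemma agree_chain (x : nat -> pt) (L : nat -> nat) :
  (forall j, agree (L j) (x j) (x j.+1)) -> (forall j, (L j < L j.+1)%N) ->
  forall j k, (j <= k)%N -> agree (L j) (x j) (x k).
Proof.
move=> xL Llt j k; elim: k => [|k IH]; first by rewrite leqn0 => /eqP ->.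
rewrite leq_eqVlt => /predU1P[->//|jk].
apply: (agree_trans (IH jk)); apply: agree_leq (xL k).
exact: (homo_leq (leqnn) leq_trans (fun i => ltnW (Llt i))).
Qed.

Lemma fusion (x : nat -> pt) (L : nat -> nat) :
  (forall j, agree (L j) (x j) (x j.+1)) -> (forall j, (L j < L j.+1)%N) ->
  exists y, forall j, agree (L j) (x j) y.
Proof.
(* Coordinate [i] no longer changes from stage [i.+1] on, because [L i.+1] exceeds [i]. *)
move=> xL Llt; exists (fun i => x i.+1 i) => j i iL.
have [ji|ij] := leqP j i.+1; first exact: (agree_chain xL Llt ji).
apply/esym/(agree_chain xL Llt (ltnW ij)).
elim: (i.+1) (leqnn i.+1) => // n IH; rewrite ltnS => ni.
have : (n <= L n)%N by elim: (n) => // m; move/leq_ltn_trans; apply.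
by move=> h; apply: leq_ltn_trans (Llt n); apply: leq_trans h.
Qed.

(** The Baire category theorem: cylinders are shrunk into the sets [D k] one after another, and
    their fusion lies in all of them. *)
Lemma baire D x L : (forall k, dense_interior (D k)) ->
  exists2 y, agree L x y & forall k, D k y.
Proof.
move=> dD.
have step k (p : pt * nat) : exists q : pt * nat, [/\ (p.2 < q.2)%N,
    agree p.2 p.1 q.1 & forall y, agree q.2 q.1 y -> D k y].
  have [y [M [py yM]]] := dD k p.1 p.2.
  exists (y, maxn p.2.+1 M); split => //=; first by rewrite leq_max leqnn.
  by move=> z yz; apply: yM; apply: agree_leq yz; rewrite leq_maxr.
pose s k p := projT1 (cid (step k p)).
have sP k p := projT2 (cid (step k p)); rewrite -/(s _ _) in sP.
pose w := fix w n := if n is n'.+1 then s n' (w n') else (x, L).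
have [|n|y yP] := @fusion (fun n => (w n).1) (fun n => (w n).2).
- by move=> n /=; have [] := sP n (w n).
- by have [] := sP n (w n).
exists y => [|k]; first exact: (yP 0%N).
by have [_ _] := sP k (w k); apply; exact: (yP k.+1).
Qed.

(** Equality with an open set modulo a meager set; the exceptional set is the complement of the
    intersection of the [D k]. *)
Definition baire_property (B : set pt) := exists U D,
  [/\ seq_open U, forall k, dense_interior (D k) &
      forall x, (forall k, D k x) -> (B x <-> U x)].

Lemma baire_property_open U : seq_open U -> baire_property U.
Proof.
by move=> oU; exists U, (fun=> setT); split => // _ x L; exists x, L.
Qed.

Lemma sigma_algebra_baire : sigma_algebra setT baire_property.
Proof.
split.
- by apply: baire_property_open.
- move=> B [U [D [oU dD BU]]].
  (* [V] is the exterior of [U]. The union of [U] and [V] is open and dense; it joins the family as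
     number 0 and discards the boundary of [U]. *)
  pose V x := exists L, forall y, agree L x y -> ~ U y.
  have oV : seq_open V.
    move=> x [L Lx]; exists L => y xy; exists L => z yz.
    by apply: Lx; apply: agree_trans yz.
  exists V, (fun k => if k is k'.+1 then D k' else U `|` V).
  split => //.
  + case=> // x L; have [[y xy Uy]|nU] := pselect (exists2 y, agree L x y & U y).
      by have [M yM] := oU y Uy; exists y, M; split => // z /yM; left.
    exists x, L; split => // y xy; right; exists L => z yz Uz.
    by apply: nU; exists z => //; apply: agree_trans yz.
  + move=> x Dx; have := Dx 0%N => /= UV.
    have BUx := BU x (fun k => Dx k.+1).
    split=> [[_ nB]|[L Lx]]; first by case: UV => // /BUx.
    by split => // /BUx; exact: Lx.
- move=> B BP.
  have {BP} [U /choice[D UD]] := choice BP.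
  exists (\bigcup_i U i).
  (* Coding pairs of indices merges countably many families into one; numbers coding no pair get the
     whole space. *)
  exists (fun n => if unpickle n is Some (i, k) then D i k else setT).
  split.
  + move=> x [i _ Ux]; have [oU _ _] := UD i.
    by have [L Lx] := oU x Ux; exists L => y /Lx; exists i.
  + move=> n; case: (unpickle n) => [[i k]|]; last by move=> x L; exists x, L.
    by have [_ dD _] := UD i.
  + move=> x Dx; have BUx i : B i x <-> U i x.
      have [_ _] := UD i; apply=> k.
      by have := Dx (pickle (i, k)); rewrite pickleK.
    by split=> -[i _ /BUx]; exists i.
Qed.

End category.

(** * Borel maps on the cube and the property of Baire *)

Section cube.
Context {R : realType}.
Implicit Types (f : R -> R) (y : hilbert_cube R).

Lemma cube_itv y n : 0 <= set_val (y n) <= 1.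
Proof. by have := set_mem (svalP (y n)); rewrite /= in_itv. Qed.

Lemma cube_dist_itv y y' n : 0 <= `|set_val (y' n) - set_val (y n)| <= 1.
Proof.
by apply: itv01_dist; exact: cube_itv.
Qed.

Lemma cube_coord_continuous n : continuous (fun y => set_val (y n) : R).
Proof.
move=> y; apply: (@continuous_comp (hilbert_cube R) _ _
  (fun y : hilbert_cube R => y n) set_val).
  exact: (@proj_continuous nat (fun=> set_type (`[0, 1]%classic : set R)) n y).
exact: (@initial_continuous _ _ set_val).
Qed.

Lemma borel_setC (X : topologicalType) (A : set X) :
  borel_set A -> borel_set (~` A).
Proof. by rewrite -setTD; apply: sigma_algebraCD. Qed.

Lemma borel_setI (X : topologicalType) (A B : set X) :
  borel_set A -> borel_set B -> borel_set (A `&` B).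
Proof.
move=> bA bB; rewrite -(setCK (A `&` B)) setCI -bigcup2E.
apply: borel_setC; apply: sigma_algebra_bigcup => -[|[|i]] /=.
- exact: borel_setC.
- exact: borel_setC.
- exact: sigma_algebra0.
Qed.

Lemma borel_cube_coord n (a b : R) :
  borel_set [set y : hilbert_cube R | a <= set_val (y n) < b].
Proof.
have op c : borel_set [set y : hilbert_cube R | set_val (y n) < c].
  apply: sub_gen_smallest.
  have /continuousP/(_ _ (@open_lt R c)) := @cube_coord_continuous n.
  by [].
rewrite (_ : mkset _ = [set y : hilbert_cube R | set_val (y n) < b] `&`
    ~` [set y : hilbert_cube R | set_val (y n) < a]).
  apply: borel_setI => //.
  by apply: borel_setC; apply: op.
apply/seteqP; split => y /=.
  by move=> /andP[ay yb]; split => //; apply/negP; rewrite -leNgt.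
by move=> [yb /negP]; rewrite -leNgt => ->.
Qed.

Lemma sum_relP f y y' : (forall x : R, 0 <= x <= 1 -> 0 <= f x) ->
  sum_rel f y y' <->
  bounded_sums (fun n => f `|set_val (y' n) - set_val (y n)|).
Proof.
move=> f0; pose u n := f `|set_val (y' n) - set_val (y n)|.
have u0 n : 0 <= u n by apply/f0/cube_dist_itv.
rewrite /sum_rel -/u; split=> [fin|[B uB]].
  exists (fine (\sum_(0 <= n <oo) (u n)%:E)) => N.
  rewrite -lee_fin -sumEFin fineK.
    apply: (@nneseries_lim_ge R (fun n => (u n)%:E) xpredT 0%N N) => n _ _.
    by rewrite lee_fin.
  rewrite ge0_fin_numE //.
  by apply: nneseries_ge0 => n _ _; rewrite lee_fin.
suff : (\sum_(0 <= n <oo) (u n)%:E <= B%:E)%E.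
  by move=> /le_lt_trans; apply; exact: ltry.
apply: lime_le.
  by apply: is_cvg_nneseries => n _ _; rewrite lee_fin.
by near=> N; rewrite sumEFin lee_fin; apply: uB.
Unshelve. all: by end_near. Qed.

Fact dyadic_itv i (k : 'I_(2 ^ i).+1) :
  (k%:R / 2 ^+ i : R) \in (`[0, 1]%classic : set R).
Proof.
apply/mem_set; rewrite /= in_itv /= divr_ge0 ?exprn_ge0 //=.
by rewrite ler_pdivrMr ?exprn_gt0 // mul1r -natrX ler_nat -ltnS.
Qed.

(** Finite coordinate sets leave only finitely many heads of a given length, while the refining
    grids make a step [2 ^- m] available at every coordinate from [m] on. *)
Definition dyadic_point (x : forall i, 'I_(2 ^ i).+1) : hilbert_cube R :=
  fun i => exist _ ((x i)%:R / 2 ^+ i : R) (dyadic_itv (x i)).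

Lemma dyadic_pointE x i : set_val (dyadic_point x i) = (x i)%:R / 2 ^+ i :> R.
Proof. by []. Qed.

Lemma dyadic_point_open (U : set (hilbert_cube R)) :
  open U -> seq_open (dyadic_point @^-1` U).
Proof.
move=> oU x Ux.
(* [F] is the neighbourhood filter of [x]; convergence along it, checked coordinatewise, is
   continuity of [dyadic_point]. *)
pose F : set_system (forall i, 'I_(2 ^ i).+1) :=
  [set V | exists L, forall z, agree L x z -> V z].
have FF : Filter F.
  split; first by exists 0%N.
    move=> V W [L VL] [M WM]; exists (maxn L M) => z xz; split.
      by apply: VL; apply: agree_leq xz; rewrite leq_maxl.
    by apply: WM; apply: agree_leq xz; rewrite leq_maxr.
  by move=> V W VW [L VL]; exists L => z /VL /VW.
have : dyadic_point @ F --> dyadic_point x.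
  apply/cvg_sup => i V [_ [[W oW <-] /= Wx WV]].
  exists i.+1 => z xz; apply: WV; rewrite /= /dyadic_point.
  by move: Wx; rewrite /= /dyadic_point /prod_topology /= (xz i).
by apply; apply: open_nbhs_nbhs.
Qed.

Lemma baire_property_borel (theta : hilbert_cube R -> hilbert_cube R) :
  borel_fun theta -> forall B, borel_set B ->
  baire_property [set x | B (theta (dyadic_point x))].
Proof.
move=> btheta B /btheta.
pose G := [set B : set (hilbert_cube R) |
            baire_property (dyadic_point @^-1` B)].
rewrite -[X in _ -> X]/(G (theta @^-1` B)).
apply: smallest_sub; last first.
  by move=> U oU; apply/baire_property_open/dyadic_point_open.
have [b0 bC bU] := @sigma_algebra_baire (fun i => 'I_(2 ^ i).+1).
split => //.
- by move=> C GC; apply: bC.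
- by move=> C GC; rewrite /G /= preimage_bigcup; apply: bU.
Qed.

End cube.

(** * Genericity for all heads over a common tail *)

Section heads.
Context {A : nat -> finType}.
Local Notation pt := (forall i, A i).
Implicit Types (x y z r : pt).

Lemma finite_heads (z0 : pt) (L : nat) :
  exists (I : finType) (e : I -> pt), forall x, exists i, agree L x (e i).
Proof.
pose e (d : {dffun forall i : 'I_L, A i}) : pt := fun j =>
  match @idP (j < L)%N with
  | ReflectT h => d (Ordinal h) | ReflectF _ => z0 j end.
exists {dffun forall i : 'I_L, A i}, e => x.
exists (finfun (fun i : 'I_L => x i)) => j jL; rewrite /e.
by case: {-}_ / idP => // h; rewrite ffunE.
Qed.

(** The finitely many heads are treated in turn, each time extending only the tail; persistence of
    [P] preserves what was achieved for earlier heads. *)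
Lemma persistent_heads (P : pt -> nat -> Prop) (L : nat) :
  (forall x y M M', P x M -> (M <= M')%N -> agree M x y -> P y M') ->
  (forall x M, exists y M', [/\ (M <= M')%N, agree M x y & P y M']) ->
  forall x M, exists y M', [/\ (M <= M')%N, agree M x y &
    forall r, P (splice L r y) M'].
Proof.
move=> Ppers Pdense x M.
have [I [e eP]] := finite_heads x L.
suff [y [M' [MM' xy Py]]] : exists y M', [/\ (maxn L M <= M')%N, agree M x y &
    forall i, i \in enum I -> P (splice L (e i) y) M'].
  exists y, M'; split=> //; first by apply: leq_trans MM'; rewrite leq_maxr.
  move=> r; have [i ri] := eP r.
  have := Py i (mem_enum _ _); rewrite (_ : splice L (e i) y = splice L r y) //.
  apply: functional_extensionality_dep => j; rewrite /splice.
  by case: ifP => // jL; rewrite ri.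
elim: (enum I) => [|i s [y [M' [MM' xy Py]]]].
  by exists x, (maxn L M).
have [w [M'' [MM'' yw Pw]]] := Pdense (splice L (e i) y) M'.
(* The point [w] carries the head [e i]; the old head is restored and only the tail of [w] is
   kept. *)
exists (splice L y w), M''; split.
- exact: leq_trans MM' MM''.
- apply: (agree_trans xy) => j jM; rewrite /splice; case: ifP => // jL.
  rewrite -yw /splice ?jL //; apply: leq_trans MM'.
  by apply: leq_trans jM _; rewrite leq_maxr.
- have wE : splice L (e i) (splice L y w) = w.
    apply: functional_extensionality_dep => j; rewrite /splice.
    case: ltnP => // jL; rewrite -yw /splice ?jL //; apply: leq_trans MM'.
    by rewrite leq_max jL.
  move=> k; rewrite inE => /predU1P[->|ks]; first by rewrite wE.
  apply: Ppers (Py k ks) MM'' _ => j jM; rewrite /splice.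
  by case: ltnP => // jL; rewrite -yw // /splice ltnNge jL.
Qed.

Lemma dense_interior_heads (E : set pt) (L : nat) :
  dense_interior E -> dense_interior [set y | forall r, E (splice L r y)].
Proof.
move=> dE x M.
have [||y [M' [_ xy yP]]] := @persistent_heads
    (fun y M => forall z, agree M y z -> E z) L _ _ x M.
- move=> u v k k' uE kk uv z vz; apply: uE.
  by apply: (agree_trans uv); apply: agree_leq vz.
- move=> u k; have [y [M' [uy yE]]] := dE u k.
  exists y, (maxn k M'); split; rewrite ?leq_maxl // => z yz.
  by apply: yE; apply: agree_leq yz; rewrite leq_maxr.
exists y, M'; split => // z yz r; apply: (yP r).
exact: agree_splice2.
Qed.

End heads.


(** * One stage of the construction, for a map [th] continuous on the comeager set [C] *)

Section stage.
Context {R : realType} {A : nat -> finType}.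
Local Notation pt := (forall i, A i).
Variables (th : pt -> nat -> R) (D : nat -> set pt) (f : R -> R).
Let C : set pt := [set x | forall k, D k x].
Hypothesis th01 : forall x n, 0 <= th x n <= 1.
Hypothesis dD : forall k, dense_interior (D k).
Hypothesis th_cont : forall x, C x -> forall n (delta : R), 0 < delta ->
  exists M, forall y, C y -> agree M x y -> `|th y n - th x n| < delta.
Hypothesis f_ge0 : forall t : R, 0 <= t <= 1 -> 0 <= f t.
Hypothesis f0 : f 0 = 0.
Hypothesis f_cont : forall t : R, 0 <= t <= 1 -> forall eta : R, 0 < eta ->
  exists2 rho : R, 0 < rho & forall s : R, 0 <= s <= 1 -> `|s - t| < rho ->
    `|f s - f t| < eta.
Hypothesis th_tail : forall L x y, (forall i, (L <= i)%N -> x i = y i) ->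
  bounded_sums (fun n => f `|th y n - th x n|).

Definition dist_sum (a b : nat) (x y : pt) : R :=
  \sum_(a <= n < b) f `|th y n - th x n|.

Lemma th_dist01 x y n : 0 <= `|th y n - th x n| <= 1.
Proof. exact: itv01_dist.
Qed.

Lemma dist_sum_continuous x x' a b (delta : R) : C x -> C x' -> 0 < delta ->
  exists M, forall y y', C y -> C y' -> agree M x y -> agree M x' y' ->
    `|dist_sum a b y y' - dist_sum a b x x'| < delta.
Proof.
move=> Cx Cx'.
have term n (eta : R) : 0 < eta -> exists M, forall y y', C y -> C y' ->
    agree M x y -> agree M x' y' ->
    `|f `|th y' n - th y n| - f `|th x' n - th x n| | < eta.
  move=> eta0; have [rho rho0 rhoP] := f_cont (th_dist01 x x' n) eta0.
  have r20 : 0 < rho / 2 by rewrite divr_gt0.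
  have [M MP] := th_cont Cx n r20; have [M' MP'] := th_cont Cx' n r20.
  exists (maxn M M') => y y' Cy Cy' xy xy'; apply: rhoP; first exact: th_dist01.
  have h1 : `|th y n - th x n| < rho / 2.
    by apply: MP => //; apply: agree_leq xy; rewrite leq_maxl.
  have h2 : `|th y' n - th x' n| < rho / 2.
    by apply: MP' => //; apply: agree_leq xy'; rewrite leq_maxr.
  apply: le_lt_trans (ler_dist_dist _ _) _.
  rewrite (_ : _ - _ - _ = (th y' n - th x' n) - (th y n - th x n)); last by ring.
  by apply: le_lt_trans (ler_normB _ _) _; lra.
elim: b delta => [|b IH] delta d0.
  by exists 0%N => y y' _ _ _ _; rewrite /dist_sum !big_geq // subr0 normr0.
have [ba|ab] := ltnP b a.
  by exists 0%N => y y' _ _ _ _; rewrite /dist_sum !big_geq // subr0 normr0.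
have d20 : 0 < delta / 2 by rewrite divr_gt0.
have [M MP] := IH _ d20; have [M' MP'] := term b _ d20.
exists (maxn M M') => y y' Cy Cy' xy xy'.
rewrite /dist_sum !big_nat_recr //= -!/(dist_sum _ _ _ _).
have h1 := MP y y' Cy Cy' (agree_leq (leq_maxl _ _) xy)
                          (agree_leq (leq_maxl _ _) xy').
have h2 := MP' y y' Cy Cy' (agree_leq (leq_maxr _ _) xy)
                           (agree_leq (leq_maxr _ _) xy').
rewrite opprD addrACA.
by apply: le_lt_trans (ler_normD _ _) _; lra.
Qed.

Lemma stage_tail (z0 : pt) L N (delta : R) : 0 < delta ->
  exists b M N', (N < N')%N /\
  forall y, agree M b y -> forall r r', C (splice L r y) -> C (splice L r' y) ->
    forall N'', dist_sum N' N'' (splice L r y) (splice L r' y) <= delta.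
Proof.
move=> d0; apply: contrapT => nb.
(* If the claim fails, every V l has dense interior, and for a point generic for
   all of them some pair of heads has a divergent sum. *)
pose V l : set pt := [set z | exists r r', C (splice L r z) -> C (splice L r' z) ->
  exists N'', delta < dist_sum (l + N.+1) N'' (splice L r z) (splice L r' z)].
have dV l : dense_interior (V l).
  (* If no smaller cylinder lay in [V l], this one would witness the claim: an excess over [delta]
     at one of its points persists on a cylinder by continuity. *)
  move=> x M; apply: contrapT => nV; apply: nb.
  exists x, M, (l + N.+1)%N; split; first by rewrite addnS ltnS leq_addl.
  move=> y xy r r' Cr Cr' N''; rewrite leNgt; apply/negP => dS; apply: nV.
  have [|M' M'P] := @dist_sum_continuous _ _ (l + N.+1) N''
    (dist_sum (l + N.+1) N'' (splice L r y) (splice L r' y) - delta) Cr Cr'.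
    by rewrite subr_gt0.
  exists y, M'; split => // z yz; exists r, r' => Cz Cz'; exists N''.
  have := M'P _ _ Cz Cz' (agree_splice2 _ _ yz) (agree_splice2 _ _ yz).
  by rewrite ltr_norml => /andP[]; lra.
(* Even indices put every head over [y] into [C], odd ones put [y] into each [V l]; a single use of
   [baire] gives both. *)
pose E n : set pt := if odd n then V n./2 else
  [set y | forall r, D n./2 (splice L r y)].
have dE n : dense_interior (E n).
  by rewrite /E; case: ifP => _; [exact: dV|exact/dense_interior_heads/dD].
have [y _ Ey] := baire z0 0 dE.
have Cy r : C (splice L r y).
  by move=> k; have := Ey k.*2; rewrite /E odd_double doubleK; apply.
have Vy l : V l y by have := Ey l.*2.+1; rewrite /E /= odd_double uphalf_double.
(* Only finitely many pairs of heads matter, each with a summable difference by [th_tail]; the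
   largest of their tail indices contradicts [Vy]. *)
have [I [e eP]] := finite_heads z0 L.
have tails (p : I * I) : exists l, forall N1 N2, (l <= N1)%N ->
    dist_sum N1 N2 (splice L (e p.1) y) (splice L (e p.2) y) <= delta.
  apply: bounded_sums_tail => // [n|]; first exact/f_ge0/th_dist01.
  by apply: (@th_tail L) => i Li; rewrite /splice ltnNge Li.
have [l lP] := choice tails.
have [r [r' /(_ (Cy r) (Cy r'))[N'']]] := Vy (\max_p l p)%N.
have [i ri] := eP r; have [i' ri'] := eP r'.
have sE u v : agree L u v -> splice L u y = splice L v y.
  move=> uv; apply: functional_extensionality_dep => j; rewrite /splice.
  by case: ifP => // jL; rewrite uv.
rewrite (sE _ _ ri) (sE _ _ ri') ltNge => /negP; apply.
apply: (lP (i, i')); apply: leq_trans (leq_addr _ _).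
exact: (leq_bigmax (i, i')).
Qed.

(** The block is refined three times: [b0] limits the influence of heads on outputs from [N'] on,
    [b1] forces [D K], and [b2] makes the outputs below [N'] almost independent of coordinates from
    [L'] on. The first comes first because it determines [N']. *)
Lemma stage (z0 : pt) K L N (delta : R) : 0 < delta ->
  exists b L' N', [/\ (L < L')%N, (N < N')%N,
  forall y, (forall i, (L <= i < L')%N -> y i = b i) -> D K y,
  forall y y', C y -> C y' -> (forall i, (L <= i < L')%N -> y i = b i) ->
    (forall i, (L <= i)%N -> y i = y' i) ->
    forall N'', dist_sum N' N'' y y' <= delta &
  forall y y', C y -> C y' -> (forall i, (L <= i < L')%N -> y i = b i) ->
    agree L' y y' -> dist_sum 0 N' y y' <= delta].
Proof.
move=> d0; have [b0 [M0 [N' [NN' b0P]]]] := stage_tail z0 L N d0.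
have [||b1 [M1 [MM1 b01 b1P]]] := @persistent_heads _
    (fun y M => forall z, agree M y z -> D K z) L _ _ b0 (maxn M0 L.+1).
- move=> u v k k' uE kk uv z vz; apply: uE.
  by apply: (agree_trans uv); apply: agree_leq vz.
- move=> u k; have [y [M' [uy yE]]] := dD K u k.
  exists y, (maxn k M'); split; rewrite ?leq_maxl // => z yz.
  by apply: yE; apply: agree_leq yz; rewrite leq_maxr.
have [||b2 [M2 [MM2 b12 b2P]]] := @persistent_heads _
    (fun y M => forall z z', C z -> C z' -> agree M y z -> agree M y z' ->
      dist_sum 0 N' z z' <= delta) L _ _ b1 M1.
- move=> u v k k' uE kk uv z z' Cz Cz' vz vz'; apply: uE => //.
    by apply: (agree_trans uv); apply: agree_leq vz.
  by apply: (agree_trans uv); apply: agree_leq vz'.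
- move=> u k; have [y uy Cy] := baire u k dD.
  (* At the diagonal pair [(y, y)] the sum vanishes since [f 0 = 0], so by continuity it stays below
     [delta] nearby. *)
  have [M' MP] := dist_sum_continuous 0 N' Cy Cy d0.
  exists y, (maxn k M'); split; rewrite ?leq_maxl // => z z' Cz Cz' yz yz'.
  have := MP z z' Cz Cz' (agree_leq (leq_maxr _ _) yz)
                         (agree_leq (leq_maxr _ _) yz').
  rewrite {2}/dist_sum big1; last by move=> i _; rewrite subrr normr0.
  by rewrite subr0 => /ltW; apply: le_trans; exact: ler_norm.
have b2y y : (forall i, (L <= i < M2)%N -> y i = b2 i) ->
    agree M2 (splice L y b2) y.
  move=> yb i iM; rewrite /splice; case: ltnP => // Li.
  by rewrite yb // Li.
have yb2 y : (forall i, (L <= i < M2)%N -> y i = b2 i) ->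
    agree M2 b2 (splice L b2 y).
  move=> yb i iM; rewrite /splice; case: ltnP => // Li.
  by rewrite yb // Li.
have spl y y' : (forall i, (L <= i)%N -> y i = y' i) ->
    splice L y' (splice L b2 y) = y'.
  move=> yy'; apply: functional_extensionality_dep => j; rewrite /splice.
  by case: ltnP => // Lj; rewrite yy'.
exists b2, M2, N'; split => //.
- by apply: leq_trans MM2; apply: leq_trans MM1; rewrite leq_maxr.
- move=> y yb; apply: (b1P y).
  apply: agree_trans (agree_leq MM2 (b2y y yb)).
  exact/agree_splice2/b12.
- move=> y y' Cy Cy' yb yy' N''.
  have := b0P (splice L b2 y) _ y y' _ _ N''; rewrite !spl //; apply => //.
  apply: agree_trans (agree_leq _ (yb2 y yb)).
    apply: agree_trans (agree_leq _ b01) (agree_leq _ b12); first by rewrite leq_maxl.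
    by apply: leq_trans MM1; rewrite leq_maxl.
  by apply: leq_trans MM2; apply: leq_trans MM1; rewrite leq_maxl.
- move=> y y' Cy Cy' yb yy'; apply: (b2P y) => //; first exact: b2y.
  exact: agree_trans (b2y y yb) yy'.
Qed.

End stage.

(** * Points with prescribed values off a sparse set of free coordinates *)

Section template.
Context {A : nat -> finType}.
Local Notation pt := (forall i, A i).
Variables (L : nat -> nat) (b : pt).
Hypothesis Lmono : forall j, (L j < L j.+1)%N.

Definition template (x : pt) : pt :=
  fun i => if `[< exists j, i = L j >] then x i else b i.

Lemma template_free x j : template x (L j) = x (L j).
Proof. by rewrite /template; case: asboolP => // -[]; exists j. Qed.

Lemma template_fixed x j i : (L j < i < L j.+1)%N -> template x i = b i.
Proof.
move=> /andP[ji ij]; rewrite /template; case: asboolP => // -[k iE]; exfalso.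
move: ji ij; rewrite iE; case: (leqP k j) => [/(strict_leq Lmono)|].
  by rewrite leqNgt => /negbTE ->.
by move=> /(strict_leq Lmono) + _; rewrite ltnNge => ->.
Qed.

Lemma eq_template x y i : x i = y i -> template x i = template y i.
Proof. by rewrite /template => ->. Qed.

End template.

(** * Iterating the stages: outputs that are almost additive *)

Section fusion.
Context {R : realType} {A : nat -> finType}.
Local Notation pt := (forall i, A i).
Variables (th : pt -> nat -> R) (D : nat -> set pt) (f : R -> R).
Let C : set pt := [set x | forall k, D k x].
Hypothesis th01 : forall x n, 0 <= th x n <= 1.
Hypothesis dD : forall k, dense_interior (D k).
Hypothesis th_cont : forall x, C x -> forall n (delta : R), 0 < delta ->
  exists M, forall y, C y -> agree M x y -> `|th y n - th x n| < delta.
Hypothesis f_ge0 : forall t : R, 0 <= t <= 1 -> 0 <= f t.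
Hypothesis f0 : f 0 = 0.
Hypothesis f_cont : forall t : R, 0 <= t <= 1 -> forall eta : R, 0 < eta ->
  exists2 rho : R, 0 < rho & forall s : R, 0 <= s <= 1 -> `|s - t| < rho ->
    `|f s - f t| < eta.
Hypothesis th_tail : forall L x y, (forall i, (L <= i)%N -> x i = y i) ->
  bounded_sums (fun n => f `|th y n - th x n|).
Local Notation dist_sum := (dist_sum th f).

(** [stage] is iterated with accuracy [2 ^- j.+1] and block start [(L j).+1], which leaves
    coordinate [L j] free. The [j]-th block forces [D j] whatever the other coordinates are, so
    every template lies in [C]. *)
Lemma fusion_template (z0 : pt) : exists (L N : nat -> nat) (b : pt),
  [/\ L 0%N = 0%N /\ N 0%N = 0%N, forall j, (L j < L j.+1)%N,
  forall j, (N j < N j.+1)%N,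
  forall j x y, agree (L j.+1) (template L b x) (template L b y) ->
    dist_sum 0 (N j.+1) (template L b x) (template L b y) <= 2 ^- j.+1 &
  forall j x y, (forall i, (L j.+1 <= i)%N -> x i = y i) -> forall N'',
    dist_sum (N j.+1) N'' (template L b x) (template L b y) <= 2 ^- j.+1].
Proof.
have d0 j : 0 < 2 ^- j.+1 :> R by rewrite invr_gt0 exprn_gt0.
(* A state holds the current point, the next free coordinate [L j] and the output bound [N j]. *)
pose S := (pt * nat * nat)%type.
pose P (j : nat) (s t : S) := [/\ (s.1.2 < t.1.2)%N, (s.2 < t.2)%N,
  agree s.1.2.+1 s.1.1 t.1.1 &
  [/\ forall y, (forall i, (s.1.2 < i < t.1.2)%N -> y i = t.1.1 i) -> D j y,
  forall y y', C y -> C y' -> (forall i, (s.1.2 < i < t.1.2)%N -> y i = t.1.1 i) ->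
    (forall i, (s.1.2 < i)%N -> y i = y' i) ->
    forall N'', dist_sum t.2 N'' y y' <= 2 ^- j.+1 &
  forall y y', C y -> C y' -> (forall i, (s.1.2 < i < t.1.2)%N -> y i = t.1.1 i) ->
    agree t.1.2 y y' -> dist_sum 0 t.2 y y' <= 2 ^- j.+1]].
have step j s : exists t, P j s t.
  have [b [L' [N' [LL NN DP tailP headP]]]] :=
    stage th01 dD th_cont f_ge0 f0 f_cont th_tail z0 j s.1.2.+1 s.2 (d0 j).
  have bE y : (forall i, (s.1.2 < i < L')%N -> y i = splice s.1.2.+1 s.1.1 b i) ->
      forall i, (s.1.2 < i < L')%N -> y i = b i.
    by move=> yb i iL; rewrite yb // /splice ltnS leqNgt; case/andP: iL => ->.
  exists (splice s.1.2.+1 s.1.1 b, L', N'); split => //=.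
  - exact: ltnW.
  - exact: agree_splice.
  - split => [y /bE|y y' Cy Cy' /bE|y y' Cy Cy' /bE]; first exact: DP.
      exact: tailP.
    exact: headP.
have [F FP] : exists F : nat -> S -> S, forall j s, P j s (F j s).
  have /choice[F FP] : forall js : nat * S, exists t, P js.1 js.2 t by move=> [].
  by exists (fun j s => F (j, s)) => j s; exact: FP (j, s).
pose w := fix w n : S := if n is n'.+1 then F n' (w n') else (z0, 0%N, 0%N).
have wP j : P j (w j) (w j.+1) by exact: FP.
pose L j := (w j).1.2; pose N j := (w j).2.
have Lmono j : (L j < L j.+1)%N by case: (wP j).
have [|j|b bP] := @fusion A (fun j => (w j).1.1) (fun j => (L j).+1).
- by move=> j; case: (wP j).
- exact: Lmono.
pose h := template L b.
have hb x j i : (L j < i < L j.+1)%N -> h x i = (w j.+1).1.1 i.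
  move=> ij; rewrite /h (template_fixed _ _ _ ij) // bP //.
  by case/andP: ij => _ /ltnW.
have hC x : C (h x).
  by move=> j; have [_ _ _ [Dj _ _]] := wP j; apply: Dj => i; apply: hb.
exists L, N, b; split => //.
- by move=> j; case: (wP j).
- move=> j x y xy; have [_ _ _ [_ _ headj]] := wP j.
  by apply: headj => // i; apply: hb.
- move=> j x y xy N''; have [_ _ _ [_ tailj _]] := wP j.
  apply: tailj => // [i|i Li]; first exact: hb.
  have [iL|/xy xyi] := ltnP i (L j.+1); last exact: eq_template.
  by rewrite -!/(h _) !(hb _ j) ?Li.
Qed.

(** On the [j]-th output block, the inputs after [L j] are erased first (head estimate), then those
    before [L j] (tail estimate). The two comparisons stay separate because the [f]-sums satisfy no
    triangle inequality here; transitivity of the relation joins them later. *)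
Lemma template_approximation (z0 : pt) :
  exists (L N : nat -> nat) (b : pt) (jn : nat -> nat),
  let h := template L b in
  [/\ N 0%N = 0%N, forall j, (L j < L j.+1)%N, forall j, (N j < N j.+1)%N,
  forall n j, (N j <= n < N j.+1)%N -> jn n = j &
  forall x, exists x' : nat -> pt,
    bounded_sums (fun n => f `|th (h (x' (jn n))) n - th (h x) n|) /\
    bounded_sums (fun n =>
      f `|th (h (fun i => if i == L (jn n) then x i else z0 i)) n -
          th (h (x' (jn n))) n|)].
Proof.
have [L [N [b [[L0 N0] Lmono Nmono headP tailP]]]] := fusion_template z0.
have [jn jnP] := block_index N0 Nmono.
exists L, N, b, jn => h; split => // x.
have f0' (y y' : pt) n : 0 <= f `|th y' n - th y n| by apply/f_ge0/th_dist01.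
exists (fun j => splice (L j).+1 x z0).
split; apply/(bounded_sums_blocks _ N0 Nmono) => //.
- apply: bounded_sums_geometric => j.
  rewrite (_ : \sum_(_ <= _ < _) _ =
    dist_sum (N j) (N j.+1) (h x) (h (splice (L j).+1 x z0))); last first.
    by apply: eq_big_nat => n /jnP ->.
  apply: (@le_trans _ _ (2 ^- j.+1)); last first.
    by rewrite lef_pV2 ?posrE ?exprn_gt0 // ler_eXn2l ?ltr1n.
  apply: (@le_trans _ _ (dist_sum 0 (N j.+1) (h x) (h (splice (L j).+1 x z0)))).
    rewrite /dist_sum [leRHS](big_cat_nat (leq0n (N j)) (ltnW (Nmono j))) /=.
    by rewrite lerDr sumr_ge0.
  apply: headP => i iL; have [ij|ji] := leqP i (L j).
    by apply: eq_template; rewrite /splice ltnS ij.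
  have ij : (L j < i < L j.+1)%N by rewrite ji.
  by rewrite /h !(template_fixed _ _ _ ij).
- apply: bounded_sums_geometric => j.
  pose sgl : pt := fun i => if i == L j then x i else z0 i.
  rewrite (_ : \sum_(_ <= _ < _) _ =
    dist_sum (N j) (N j.+1) (h (splice (L j).+1 x z0)) (h sgl)); last first.
    by apply: eq_big_nat => n /jnP ->.
  (* For block 0 no input precedes [L 0 = 0] and the two points coincide; block [j.+1] uses the tail
     estimate of stage [j]. *)
  case: j @sgl => [|j] sgl.
    rewrite (_ : sgl = splice (L 0%N).+1 x z0).
      by rewrite /dist_sum big1 ?expr0 ?invr1 // => n _; rewrite subrr normr0.
    by apply: functional_extensionality_dep => i; rewrite /sgl /splice L0 ltnS leqn0.
  apply: tailP => i Li; rewrite /splice /sgl ltnS.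
  by case: (ltngtP i (L j.+1)) Li.
Qed.

End fusion.

(** * From a Borel reduction to an additive one *)

Section reduction.
Context {R : realType}.
Local Notation pt := (forall i, 'I_(2 ^ i).+1).
Implicit Types (f g : R -> R) (theta : hilbert_cube R -> hilbert_cube R).

Lemma borel_generic_continuity theta : borel_fun theta ->
  exists D : nat -> set pt, (forall k, dense_interior (D k)) /\
  forall x, (forall k, D k x) -> forall n (delta : R), 0 < delta ->
  exists M, forall y, (forall k, D k y) -> agree M x y ->
    `|set_val (theta (dyadic_point y) n) - set_val (theta (dyadic_point x) n)|
      < delta.
Proof.
move=> btheta; pose th x n : R := set_val (theta (dyadic_point x) n).
have bp (nmk : nat * nat * nat) : baire_property [set x : pt |
    (nmk.2)%:R / (nmk.1.2).+1%:R <= th x nmk.1.1 < (nmk.2).+1%:R / (nmk.1.2).+1%:R].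
  exact: (baire_property_borel btheta (borel_cube_coord nmk.1.1 _ _)).
have {bp} /choice[U /choice[D UD]] := bp.
exists (fun n => if unpickle n is Some (nmk, k) then D nmk k else setT); split.
  move=> n; case: (unpickle n) => [[nmk k]|]; last by move=> x L; exists x, L.
  by have [_ dD _] := UD nmk.
move=> x Dx n delta d0.
have gen y : (forall n, (if unpickle n is Some (nmk, k) then D nmk k else setT) y) ->
    forall nmk k, D nmk k y.
  by move=> Dy nmk k; have := Dy (pickle (nmk, k)); rewrite pickleK.
(* Continuity on the generic set, from the Baire property of the preimages of
   [k/(m+1), (k+1)/(m+1)[. *)
pose m := Num.bound delta^-1; pose k := Num.trunc (th x n * m.+1%:R).
have md : m.+1%:R^-1 < delta.
  rewrite -[ltRHS]invrK ltf_pV2 ?posrE ?invr_gt0 //.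
  apply: (@lt_trans _ _ m%:R); last by rewrite ltr_nat.
  by rewrite archi_boundP // invr_ge0 ltW.
have [oU _ BU] := UD (n, m, k).
have th0 : 0 <= th x n by case/andP: (cube_itv (theta (dyadic_point x)) n).
have xk : k%:R / m.+1%:R <= th x n < k.+1%:R / m.+1%:R.
  rewrite ler_pdivrMr // ltr_pdivlMr //.
  by apply: truncn_itv; rewrite mulr_ge0.
have [M MP] := oU x ((BU x (gen x Dx _)).1 xk).
exists M => y Dy xy; have := (BU y (gen y Dy _)).2 (MP y xy).
rewrite /= -/(th y n) -/(th x n) => yk.
apply: le_lt_trans md.
have near (s t c e : R) : c <= s < c + e -> c <= t < c + e -> `|t - s| <= e.
  move=> /andP[cs se] /andP[ct te].
  by rewrite ler_norml; apply/andP; split; lra.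
have E : k.+1%:R / m.+1%:R = k%:R / m.+1%:R + m.+1%:R^-1 :> R.
  by rewrite -natr1 mulrDl mul1r.
by apply: (near _ _ (k%:R / m.+1%:R)); rewrite -E.
Qed.

(** Here [v j k] is the image of the template whose free inputs are all 0 except [k / 2 ^ L j] at
    [L j]. Finite changes of the input preserve the relation of [g], so [theta] satisfies [th_tail]
    and the template construction applies. *)
Lemma additive_reduction f g :
  (forall t : R, 0 <= t <= 1 -> 0 <= f t) -> f 0 = 0 ->
  (forall t : R, 0 <= t <= 1 -> forall eta : R, 0 < eta ->
    exists2 rho : R, 0 < rho & forall s : R, 0 <= s <= 1 -> `|s - t| < rho ->
    `|f s - f t| < eta) ->
  (forall t : R, 0 <= t <= 1 -> 0 <= g t) -> g 0 = 0 ->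
  RelationClasses.Equivalence (sum_rel f) ->
  borel_reducible (sum_rel g) (sum_rel f) ->
  exists (L N : nat -> nat) (v : nat -> nat -> nat -> R),
  [/\ forall j, (L j < L j.+1)%N, forall j k n, 0 <= v j k n <= 1 &
  forall a a' : nat -> nat, (forall j, (a j <= 2 ^ L j)%N) ->
    (forall j, (a' j <= 2 ^ L j)%N) ->
    bounded_sums (fun j => g (`|(a' j)%:R - (a j)%:R| / 2 ^+ L j)) <->
    bounded_sums (fun j => \sum_(N j <= n < N j.+1)
      f `|v j (a' j) n - v j (a j) n|)].
Proof.
move=> f_ge0 f0 f_cont g_ge0 g0 f_equiv [theta [btheta red]].
pose th x n : R := set_val (theta (dyadic_point x) n).
have th01 x n : 0 <= th x n <= 1 by exact: cube_itv.
have [D [dD th_cont]] := borel_generic_continuity btheta.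
have th_tail L0 x y : (forall i, (L0 <= i)%N -> x i = y i) ->
    bounded_sums (fun n => f `|th y n - th x n|).
  move=> xy; apply/(sum_relP (theta (dyadic_point x)) (theta (dyadic_point y)) f_ge0).
  apply/red/(sum_relP _ _ g_ge0).
  exists (\sum_(0 <= n < L0)
    g `|set_val (dyadic_point y n) - set_val (dyadic_point x n)|) => n.
  have g0' i : 0 <= g `|set_val (dyadic_point y i : set_type `[0, 1]) -
                        set_val (dyadic_point x i)|.
    exact/g_ge0/cube_dist_itv.
  have [nL|Ln] := leqP n L0; first exact: sum_nat_le.
  rewrite (big_cat_nat (leq0n L0) (ltnW Ln)) /= [X in _ + X]big_nat.
  rewrite [X in _ + X]big1 ?addr0 // => i /andP[Li _].
  by rewrite !dyadic_pointE xy // subrr normr0.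
pose z0 : pt := fun i => ord0.
have [L [N [b [jn [N0 Lmono Nmono jnP approx]]]]] :=
  template_approximation th01 dD th_cont f_ge0 f0 f_cont th_tail z0.
pose h := template L b.
pose pin j k : pt := fun i => if i == L j then inord k else ord0.
exists L, N, (fun j k n => th (h (pin j k)) n); split => //.
move=> a a' aL a'L.
have fE := sum_relP _ _ f_ge0; have gE := sum_relP _ _ g_ge0.
(* A left inverse of [L] lets [pt_of c] carry the numerator [c j] at coordinate [L j]. *)
have [l lK] : exists l : nat -> nat, cancel L l.
  suff /choice[l lP] : forall i, exists j, forall j', L j' = i -> j' = j.
    by exists l => j; apply/esym/lP.
  move=> i; have [[j ji]|ni] := pselect (exists j, L j = i).
    by exists j => j' j'i; apply: (strict_inj Lmono); rewrite ji.
  by exists 0%N => j ji; exfalso; apply: ni; exists j.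
pose pt_of (c : nat -> nat) : pt := fun i => inord (c (l i)).
(* [T c] glues, block by block, the images of inputs with a single nonzero free coordinate; it is
   [f]-equivalent to the true image, through the intermediate [T']. *)
pose T (c : nat -> nat) : hilbert_cube R :=
  fun n => theta (dyadic_point (h (pin (jn n) (c (jn n))))) n.
have TP c : sum_rel f (theta (dyadic_point (h (pt_of c)))) (T c).
  have [x' [hx' x'T]] := approx (pt_of c).
  pose T' : hilbert_cube R := fun n => theta (dyadic_point (h (x' (jn n)))) n.
  apply: (RelationClasses.Equivalence_Transitive _ T').
    by apply/fE.
  apply/fE; move: x'T; apply eq_bounded_sums => n.
  rewrite /T /T' /=; congr (f `|_ - _|); rewrite /th.
  congr (set_val (theta (dyadic_point (h _)) n)).
  apply: functional_extensionality_dep => i; rewrite /pin /pt_of.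
  by case: eqP => // ->; rewrite lK.
have fT : sum_rel f (theta (dyadic_point (h (pt_of a))))
                    (theta (dyadic_point (h (pt_of a')))) <->
    sum_rel f (T a) (T a').
  have [_ S Tr] := f_equiv.
  split=> H; first by apply: Tr (Tr _ _ _ (S _ _ (TP a)) H) (TP a').
  by apply: Tr (Tr _ _ _ (TP a) H) (S _ _ (TP a')).
apply: (@iff_trans _
  (sum_rel g (dyadic_point (h (pt_of a))) (dyadic_point (h (pt_of a'))))).
  apply: iff_sym; apply: iff_trans (gE _ _) _.
  pose u n := g `|set_val (dyadic_point (h (pt_of a')) n : set_type `[0, 1]) -
                  set_val (dyadic_point (h (pt_of a)) n)|.
  have u0 n : 0 <= u n by exact/g_ge0/cube_dist_itv.
  apply: iff_trans (bounded_sums_sparse u0 Lmono _) _.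
    move=> n nL; rewrite /u !dyadic_pointE /h /template.
    by case: asboolP => [[j /nL]//|_]; rewrite subrr normr0.
  apply: eq_bounded_sums => j; rewrite /u !dyadic_pointE /h !template_free.
  rewrite /pt_of lK !inordK ?ltnS //.
  have E : `|(a' j)%:R / 2 ^+ L j - (a j)%:R / 2 ^+ L j| =
      `|(a' j)%:R - (a j)%:R| / 2 ^+ L j :> R.
    by rewrite -mulrBl normrM [X in _ * X]ger0_norm // invr_ge0 exprn_ge0.
  exact (congr1 g E).
apply: (iff_trans (red _ _)); apply: (iff_trans fT); apply: iff_trans (fE _ _) _.
pose u n := f `|set_val (T a' n) - set_val (T a n)|.
have u0 n : 0 <= u n by exact/f_ge0/cube_dist_itv.
apply: iff_trans (bounded_sums_blocks u0 N0 Nmono) _.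
by apply: eq_bounded_sums => j; apply: eq_big_nat => n /jnP jnE; rewrite /u /T jnE.
Qed.

End reduction.

(** * Continuity of [f] and the cost of subdividing an interval *)

Section power_modulus.
Context {R : realType}.

Lemma powR_modulus_continuous (alpha : R) (phi f : R -> R) : 1 <= alpha ->
  {within `[0, 1], continuous phi} ->
  (forall x : R, 0 <= x <= 1 -> f x = x `^ alpha * phi x) ->
  forall t : R, 0 <= t <= 1 -> forall eta : R, 0 < eta ->
    exists2 rho : R, 0 < rho & forall s : R, 0 <= s <= 1 -> `|s - t| < rho ->
      `|f s - f t| < eta.
Proof.
move=> a1 phic fE t t01 eta eta0.
have a0 : 0 < alpha by lra.
have It : `[0, 1]%classic t by rewrite /= in_itv.
have phit := (subspace_continuousP _ _).1 phic t It.
have powt : s `^ alpha @[s --> within `[0, 1] (nbhs t)] --> t `^ alpha.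
  have [t0|t0] := ltP 0 t.
    have tI : t \in `]0, +oo[ by rewrite in_itv /= t0.
    have ct : {for t, continuous (fun s : R => s `^ alpha)}.
      apply: differentiable_continuous; apply/derivable1_diffP.
      exact: derivable_powR tI.
    by apply: cvg_trans ct; apply: cvg_app; exact: cvg_within.
  (* At 0 the power is controlled by [s] itself, since [1 <= alpha] and [s <= 1]. *)
  have -> : t = 0 by lra.
  rewrite powR0 ?gt_eqF //; apply/cvgrPdist_lt => e e0.
  rewrite near_withinE; apply/nbhs_ballP; exists e => // s.
  rewrite /ball /= sub0r normrN => se; rewrite in_itv /= => /andP[s0 s1].
  rewrite sub0r normrN ger0_norm ?powR_ge0 //.
  have [->|sn0] := eqVneq s 0; first by rewrite powR0 ?gt_eqF.
  apply: le_lt_trans (ge1r_powR _ a1) _; first by rewrite lt0r sn0 s0.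
  by apply: le_lt_trans se; exact: ler_norm.
have fcvg : s `^ alpha * phi s @[s --> within `[0, 1] (nbhs t)] -->
    t `^ alpha * phi t by exact: cvgM powt phit.
have nf := (cvgrPdist_lt _ _).1 fcvg _ eta0; rewrite near_withinE in nf.
 have [rho rho0 rhoP] := (nbhs_ballP _ _).1 (nf (within_filter _ _)).
exists rho => // s s01 st.
have Is : `[0, 1]%classic s by rewrite /= in_itv.
have := rhoP s _ Is; rewrite /ball /= distrC => /(_ st).
by rewrite !fE // distrC.
Qed.

Lemma subdivision_point (alpha eps D : R) (phi f : R -> R) (m : nat) (d : nat -> R) :
  1 <= alpha -> 0 < eps ->
  (forall x : R, 0 <= x <= 1 -> 0 <= phi x) ->
  (forall x : R, 0 <= x <= 1 -> f x = x `^ alpha * phi x) ->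
  (forall x y : R, 0 <= x <= 1 -> 0 <= y <= 1 ->
     phi x <= eps * phi y * phi (1 / 2 ^+ m) -> x <= y / 2 ^+ m.+1) ->
  0 <= D <= 1 -> (forall i, 0 <= d i <= 1) ->
  D <= \sum_(0 <= i < (2 ^ m)%N) d i ->
  2 ^+ m * (eps * (1 / 2) `^ alpha * f (1 / 2 ^+ m)) * f D <=
    \sum_(0 <= i < (2 ^ m)%N) f (d i).
Proof.
move=> a1 eps0 phi0 fE A1m D01 d01 Dd; have a0 : 0 < alpha by lra.
have [D0 D1] := andP D01.
have m01 := @itv01_half_powW R m.
pose K := eps * phi D * phi (1 / 2 ^+ m); pose t := D / 2 ^+ m.+1.
have K0 : 0 <= K by rewrite !mulr_ge0 ?phi0 ?(ltW eps0).
have t0 : 0 <= t by rewrite divr_ge0 ?exprn_ge0.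
(* The steps of length at most t = D / 2^(m+1) cover at most half of D, and the
   others satisfy phi (d i) > K by (A1) and d^alpha >= d t^(alpha-1). *)
have fd i : K * t `^ (alpha - 1) * (d i - t) <= f (d i).
  have [di0 di1] := andP (d01 i).
  have [dt|td] := leP (d i) t.
    apply: (@le_trans _ _ 0); last by rewrite fE // mulr_ge0 ?powR_ge0 ?phi0.
    by rewrite mulr_ge0_le0 ?subr_le0 // mulr_ge0 ?powR_ge0.
  have Kphi : K < phi (d i).
    rewrite ltNge; apply/negP => /(A1m _ _ (d01 i) D01).
    by rewrite -/t leNgt td.
  rewrite fE // -(mulr_powRB1 _ a0) //.
  have p0 : 0 <= t `^ (alpha - 1) by exact: powR_ge0.
  have pp : t `^ (alpha - 1) <= d i `^ (alpha - 1).
    by apply: ge0_ler_powR; rewrite ?nnegrE ?subr_ge0 // ltW.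
  apply: (@le_trans _ _ (K * t `^ (alpha - 1) * d i)).
    by apply: ler_wpM2l; [rewrite mulr_ge0|rewrite gerBl].
  rewrite mulrC -mulrA; apply: ler_wpM2l => //.
  by rewrite mulrC; apply: ler_pM => //; exact: ltW.
apply: le_trans (_ : \sum_(0 <= i < (2 ^ m)%N)
    K * t `^ (alpha - 1) * (d i - t) <= _); last first.
  by apply: ler_sum.
rewrite -mulr_sumr sumrB sumr_const_nat subn0 -(mulr_natr t) natrX.
(* Hence the sum of the [d i - t] is at least [D / 2], which is again [t * 2 ^+ m]; the factor [t]
   turns the exponent [alpha - 1] back into [alpha]. *)
have tm : t * 2 ^+ m = D / 2.
  by rewrite /t exprS invfM mulrA mulfVK // expf_neq0.
have tE : t `^ alpha = D `^ alpha * ((1 / 2 ^+ m) `^ alpha * (1 / 2) `^ alpha).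
  have [m0 _] := andP m01.
  rewrite -!powRM ?mulr_ge0 //; congr (_ `^ _).
  by rewrite /t exprS invfM; field; rewrite expf_neq0.
apply: (@le_trans _ _ (K * t `^ (alpha - 1) * (t * 2 ^+ m))); last first.
  by apply: ler_wpM2l; [rewrite mulr_ge0 ?powR_ge0|rewrite tm; lra].
have -> : K * t `^ (alpha - 1) * (t * 2 ^+ m) = K * t `^ alpha * 2 ^+ m.
  by rewrite -(mulr_powRB1 t0 a0); ring.
rewrite tE !fE //.
by rewrite /K le_eqVlt; apply/orP; left; apply/eqP; ring.
Qed.

End power_modulus.

(** * Choosing one expensive step and a suitable sequence of scales *)

Section selection.
Context {R : realType}.

(** [subdivision_point] is applied at each output coordinate to the path from [u 0] to [u (2 ^ m)].
    After exchanging the sums, a pigeonhole over the [2 ^ m] steps finds one carrying at least the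
    average. *)
Lemma subdivision (alpha eps c : R) (phi f : R -> R) (m a b : nat)
    (u : nat -> nat -> R) :
  1 <= alpha -> 0 < eps ->
  (forall x : R, 0 <= x <= 1 -> 0 <= phi x) ->
  (forall x : R, 0 <= x <= 1 -> f x = x `^ alpha * phi x) ->
  (forall x y : R, 0 <= x <= 1 -> 0 <= y <= 1 ->
     phi x <= eps * phi y * phi (1 / 2 ^+ m) -> x <= y / 2 ^+ m.+1) ->
  (forall i n, 0 <= u i n <= 1) ->
  c <= \sum_(a <= n < b) f `|u (2 ^ m)%N n - u 0%N n| ->
  exists2 i, (i < 2 ^ m)%N &
    eps * (1 / 2) `^ alpha * f (1 / 2 ^+ m) * c <=
      \sum_(a <= n < b) f `|u i.+1 n - u i n|.
Proof.
move=> a1 eps0 phi0 fE A1m u01 cu; set K := eps * _ * _.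
have dist01 i j n : 0 <= `|u i n - u j n| <= 1 by exact: itv01_dist.
have m01 := @itv01_half_powW R m.
have K0 : 0 <= K by rewrite /K fE // !mulr_ge0 ?powR_ge0 ?phi0 // ltW.
apply: contrapT => nex.
have small i : (i < 2 ^ m)%N -> \sum_(a <= n < b) f `|u i.+1 n - u i n| < K * c.
  by move=> im; rewrite ltNge; apply/negP => h; apply: nex; exists i.
have : 2 ^+ m * (K * c) <=
    \sum_(0 <= i < (2 ^ m)%N) \sum_(a <= n < b) f `|u i.+1 n - u i n|.
  rewrite exchange_big /=; apply: (@le_trans _ _
    (\sum_(a <= n < b) 2 ^+ m * K * f `|u (2 ^ m)%N n - u 0%N n|)).
    by rewrite mulrA -mulr_sumr; apply: ler_wpM2l => //; rewrite mulr_ge0 ?exprn_ge0.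
  apply: ler_sum => n _; apply: (subdivision_point _ _ phi0) => //.
  rewrite -(telescope_sumr (fun i => u i n)) //; exact: ler_norm_sum.
have : (0 < 2 ^ m)%N by rewrite expn_gt0.
rewrite -natrX; case: (2 ^ m)%N small => // k small _.
rewrite big_nat_recr //= leNgt => /negP; apply.
rewrite -natr1 mulrDl mul1r; apply: ler_ltD; last exact: small.
rewrite mulr_natl -[X in _ *+ X]subn0 -sumr_const_nat.
rewrite big_nat [leRHS]big_nat; apply: ler_sum => i /andP[_ ik].
exact/ltW/small/ltnW.
Qed.

Lemma summable_nonsummable (F G : nat -> R) (B : R) (M : nat) :
  (forall m, 0 < F m <= B) ->
  (forall m, 0 <= G m) ->
  (forall delta : R, 0 < delta -> exists2 m, (M < m)%N & G m <= delta * F m) ->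
  exists m : nat -> nat, [/\ forall k, (M < m k)%N,
    bounded_sums (fun k => G (m k)) & ~ bounded_sums (fun k => F (m k))].
Proof.
move=> FB G0 small.
(* The index m k is chosen according to the partial sum S k of F already
   reached: the ratio G/F is at most (S k + 1)^-2, and as long as S stays bounded
   only finitely many indices are used, so that S grows linearly. *)
have /choice[mu muP] : forall q : nat, exists m, (M < m)%N /\
    G m <= ((q.+2)%:R ^+ 2)^-1 * F m.
  move=> q; have [|m Mm Gm] := small ((q.+2)%:R ^+ 2)^-1; last by exists m.
  by rewrite invr_gt0 exprn_gt0.
pose S := fix S k : R := if k is k'.+1 then S k' + F (mu (Num.trunc (S k'))) else 0.
pose m k := mu (Num.trunc (S k)).
have SE k : \sum_(0 <= i < k) F (m i) = S k.
  by elim: k => [|k IH]; [rewrite big_geq|rewrite big_nat_recr //= IH].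
have S0 k : 0 <= S k.
  by rewrite -SE sumr_ge0 // => i _; case/andP: (FB (m i)) => /ltW.
have B0 : 0 < B by case/andP: (FB 0%N) => /lt_le_trans h /h.
exists m; split => [k||[B' B'P]]; first by case: (muP (Num.trunc (S k))).
- exists (1 + B) => N.
  (* Telescoping: F/(1 + S)^2 <= (1 + B) (1/(1 + S) - 1/(1 + S + F)) if F <= B. *)
  suff : \sum_(0 <= k < N) G (m k) <= (1 + B) * (1 - (1 + S N)^-1).
    move/le_trans; apply; rewrite ger_pMr ?gerBl ?invr_ge0; last by lra.
    by have := S0 N; lra.
  elim: N => [|N IH]; first by rewrite big_geq //= addr0 invr1 subrr mulr0.
  rewrite big_nat_recr //=.
  have [_] := muP (Num.trunc (S N)); rewrite -/(m N).
  have /andP[F0 FleB] := FB (m N); set q := Num.trunc (S N) => Gq.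
  (* Truncation gives [S N < q.+1], whence the [q.+2] in the choice of [mu]. *)
  have Sq : 1 + S N <= q.+2%:R.
    have /andP[_] := truncn_itv (S0 N); rewrite -/q => h.
    by rewrite -natr1 addrC lerD2r ltW.
  have s1 : 0 < 1 + S N by have := S0 N; lra.
  have s2 : 0 < 1 + (S N + F (m N)) by lra.
  have Gq2 : G (m N) <= ((1 + S N) ^+ 2)^-1 * F (m N).
    apply: le_trans Gq _; rewrite ler_wpM2r ?(ltW F0) //.
    by rewrite lef_pV2 ?posrE ?exprn_gt0 // ler_pXn2r ?nnegrE ?(ltW s1).
  have step : ((1 + S N) ^+ 2)^-1 * F (m N) <=
      (1 + B) * ((1 + S N)^-1 - (1 + (S N + F (m N)))^-1).
    have -> : (1 + S N)^-1 - (1 + (S N + F (m N)))^-1 =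
        F (m N) / ((1 + S N) * (1 + (S N + F (m N)))).
      by field; rewrite !gt_eqF.
    rewrite mulrC mulrCA ler_wpM2l ?(ltW F0) //.
    rewrite ler_pdivlMr ?mulr_gt0 // expr2 invfM mulrACA mulVf ?gt_eqF // mul1r.
    rewrite mulrC ler_pdivrMr //.
    have : 0 <= B * S N by rewrite mulr_ge0 // ltW.
    by rewrite mulrDl mul1r mulrDr mulr1; lra.
  rewrite -/q -/(m N); move: IH Gq2 step.
  set X := (_ + _)^-1; set Y := (_ + (_ + _))^-1; set Z := _^-1 * _.
  by rewrite !mulrBr; lra.
- have low Q : exists2 e : R, 0 < e & forall q, (q <= Q)%N -> e <= F (mu q).
    elim: Q => [|Q [e e0 eP]].
      exists (F (mu 0%N)); first by case/andP: (FB (mu 0%N)).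
      by move=> q; rewrite leqn0 => /eqP ->.
    exists (Num.min e (F (mu Q.+1))).
      by rewrite lt_min e0; case/andP: (FB (mu Q.+1)).
    move=> q; rewrite leq_eqVlt => /predU1P[->|qQ]; first by rewrite ge_min lexx orbT.
    by rewrite ge_min eP.
  have [e e0 eP] := low (Num.trunc B').
  have Sk k : e *+ k <= S k.
    rewrite -SE -[X in _ *+ X]subn0 -sumr_const_nat; apply: ler_sum => i _.
    by apply: eP; apply: le_truncn; rewrite -SE.
  have := le_trans (Sk (Num.bound (B' / e))) _; rewrite -SE => /(_ _ (B'P _)).
  rewrite leNgt => /negP; apply; rewrite -mulr_natr mulrC -ltr_pdivrMr //.
  apply: le_lt_trans (archi_boundP _); first by [].
  by rewrite divr_ge0 ?(ltW e0) //; have := B'P 0%N; rewrite big_geq.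
Qed.

Lemma increasing_choice (Q : nat -> nat -> Prop) :
  (forall k n, exists2 j, (n <= j)%N & Q k j) ->
  exists j : nat -> nat, (forall k, (j k < j k.+1)%N) /\ forall k, Q k (j k).
Proof.
move=> Qex.
have /choice[F FP] : forall kn : nat * nat, exists j, (kn.2 <= j)%N /\ Q kn.1 j.
  by move=> [k n]; have [j nj Qj] := Qex k n; exists j.
pose j := fix j k := if k is k'.+1 then F (k, (j k').+1) else F (0%N, 0%N).
exists j; split => [k|[|k]] /=.
- by have [] := FP (k.+1, (j k).+1).
- by have [] := FP (0%N, 0%N).
- by have [] := FP (k.+1, (j k).+1).
Qed.

(** Inputs on a subsequence of blocks are padded with 0, so that two such inputs do not differ on
    the remaining blocks. *)
Lemma sparse_extension (j : nat -> nat) : injective j ->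
  exists ext : (nat -> nat) -> nat -> nat, forall c,
    (forall k, ext c (j k) = c k) /\ forall i, (forall k, i <> j k) -> ext c i = 0%N.
Proof.
move=> jinj.
have /choice[l lP] : forall i, exists o : option nat,
    if o is Some k then i = j k else forall k, i <> j k.
  move=> i; have [[k ik]|ni] := pselect (exists k, i = j k); first by exists (Some k).
  by exists None => k ik; apply: ni; exists k.
exists (fun c i => if l i is Some k then c k else 0%N) => c; split => [k|i ni].
  by have := lP (j k); case: (l _) => [k' /jinj ->//|/(_ k)].
by have := lP i; case: (l i) => // k /ni.
Qed.

End selection.

(** * The contradiction from an additive reduction *)

Theorem theorem18 (R : realType) (alpha : R) (phi psi f g : R -> R)
  (alpha_ge1 : 1 <= alpha)
  (phi_ge0 : forall x : R, 0 <= x <= 1 -> 0 <= phi x)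
  (psi_ge0 : forall x : R, 0 <= x <= 1 -> 0 <= psi x)
  (phi_cont : {within `[0, 1], continuous phi})
  (psi_cont : {within `[0, 1], continuous psi})
  (f_def : forall x : R, 0 <= x <= 1 -> f x = x `^ alpha * phi x)
  (g_def : forall x : R, 0 <= x <= 1 -> g x = x `^ alpha * psi x)
  (f_bounded : [bounded f x | x in `[0, 1]%classic])
  (g_bounded : [bounded g x | x in `[0, 1]%classic])
  (f_equiv : RelationClasses.Equivalence (sum_rel f))
  (g_equiv : RelationClasses.Equivalence (sum_rel g))
  (psi_gt0 : forall x : R, 0 < x <= 1 -> 0 < psi x)
  (A1 : exists (eps : R) (M : nat), 0 < eps /\
     forall n : nat, (M < n)%N ->
     forall x y : R, 0 <= x <= 1 -> 0 <= y <= 1 ->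
       phi x <= eps * phi y * phi (1 / 2 ^+ n) -> x <= y / 2 ^+ n.+1)
  (A2 : psi (1 / 2 ^+ n) / phi (1 / 2 ^+ n) @[n --> \oo] --> (0 : R)) :
  ~ borel_reducible (sum_rel g) (sum_rel f).
move=> red.
have alpha0 : alpha != 0 by rewrite gt_eqF //; lra.
have f0 : f 0 = 0 by rewrite f_def ?lexx ?ler01 // powR0 ?mul0r.
have g0 : g 0 = 0 by rewrite g_def ?lexx ?ler01 // powR0 ?mul0r.
have f_ge0 (t : R) : 0 <= t <= 1 -> 0 <= f t.
  by move=> t01; rewrite f_def // mulr_ge0 ?powR_ge0 ?phi_ge0.
have g_ge0 (t : R) : 0 <= t <= 1 -> 0 <= g t.
  by move=> t01; rewrite g_def // mulr_ge0 ?powR_ge0 ?psi_ge0.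
have [eps [M [eps0 {}A1]]] := A1.
(* If [phi x = 0], (A1) with [y = x] would give [x <= x / 2 ^+ n.+1], which fails for [x > 0]. *)
have phi_gt0 (x : R) : 0 < x <= 1 -> 0 < phi x.
  move=> /andP[x0 x1]; have x01 : 0 <= x <= 1 by rewrite (ltW x0).
  rewrite lt0r phi_ge0 // andbT; apply/eqP => phix.
  have := A1 M.+1 (ltnSn M) x x x01 x01.
  rewrite phix mulr0 mul0r lexx => /(_ isT); rewrite leNgt => /negP; apply.
  by rewrite ltr_pdivrMr ?exprn_gt0 // ltr_pMr // exprn_egt1 // ltr1n.
have [B fB] : exists B : R, forall m, 0 < f (1 / 2 ^+ m) <= B.
  have [B0 [_ BP]] := f_bounded; exists (B0 + 1) => m.
  have /andP[h0 h1] := @itv01_half_pow R m.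
  rewrite {1}f_def ?itv01_half_powW // mulr_gt0 ?powR_gt0 ?phi_gt0 ?itv01_half_pow //=.
  have := BP (B0 + 1); rewrite ltrDl ltr01 => /(_ isT (1 / 2 ^+ m)) /=.
  by rewrite in_itv /= itv01_half_powW => /(_ isT); apply: le_trans; exact: ler_norm.
have small (delta : R) : 0 < delta ->
    exists2 m, (M < m)%N & g (1 / 2 ^+ m) <= delta * f (1 / 2 ^+ m).
  move=> d0; have [n _ nP] := (cvgrPdist_lt _ _).1 A2 _ d0.
  exists (maxn n M.+1); first by rewrite leq_maxr.
  have := nP (maxn n M.+1) (leq_maxl _ _); rewrite /= sub0r normrN.
  move: (maxn _ _) => m; have ph := phi_gt0 _ (itv01_half_pow m).
  move=> /(le_lt_trans (ler_norm _)); rewrite ltr_pdivrMr // => /ltW psid.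
  by rewrite g_def ?f_def ?itv01_half_powW // mulrCA ler_wpM2l ?powR_ge0.
have [L [N [v [Lmono v01 addv]]]] := additive_reduction f_ge0 f0
  (powR_modulus_continuous alpha_ge1 phi_cont f_def) g_ge0 g0 f_equiv red.
pose W j k k' := \sum_(N j <= n < N j.+1) f `|v j k' n - v j k n|.
have W_ge0 j k k' : 0 <= W j k k'.
  by apply: sumr_ge0 => n _; apply/f_ge0/itv01_dist.
have W_diag j k : W j k k = 0.
  by rewrite /W big1 // => n _; rewrite subrr normr0.
(* Additivity restricted to a subsequence of blocks: off it both inputs are 0 and contribute
   [g 0 = 0] and a diagonal [W]. *)
have addW (j c c' : nat -> nat) : (forall k, (j k < j k.+1)%N) ->
    (forall k, (c k <= 2 ^ L (j k))%N) -> (forall k, (c' k <= 2 ^ L (j k))%N) ->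
    bounded_sums (fun k => g (`|(c' k)%:R - (c k)%:R| / 2 ^+ L (j k))) <->
    bounded_sums (fun k => W (j k) (c k) (c' k)).
  move=> jmono cL c'L; have [ext extP] := sparse_extension (strict_inj jmono).
  have ext_le (d : nat -> nat) : (forall k, (d k <= 2 ^ L (j k))%N) ->
      forall i, (ext d i <= 2 ^ L i)%N.
    move=> dL i; have [dj d0] := extP d.
    have [[k ->]|ni] := pselect (exists k, i = j k); first by rewrite dj.
    by rewrite d0 // => k ik; apply: ni; exists k.
  have [cj c0] := extP c; have [c'j c'0] := extP c'.
  have {}addv := addv (ext c) (ext c') (ext_le _ cL) (ext_le _ c'L).
  have gsp : bounded_sums (fun i => g (`|(ext c' i)%:R - (ext c i)%:R| / 2 ^+ L i)) <->
      bounded_sums (fun k => g (`|(c' k)%:R - (c k)%:R| / 2 ^+ L (j k))).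
    apply: iff_trans (bounded_sums_sparse _ jmono _) _.
    - move=> i; apply: g_ge0; rewrite divr_ge0 ?exprn_ge0 //=.
      rewrite ler_pdivrMr ?exprn_gt0 // mul1r -natrX.
      have := ext_le _ cL i; have := ext_le _ c'L i; rewrite -!(ler_nat R).
      have := ler0n R (ext c i); have := ler0n R (ext c' i).
      by move=> *; rewrite ler_norml; apply/andP; split; lra.
    - by move=> i ni; rewrite c0 // c'0 // subrr normr0 mul0r.
    - by apply: eq_bounded_sums => k; rewrite cj c'j.
  apply: iff_trans (iff_sym gsp) _; apply: (iff_trans addv).
  apply: iff_trans (bounded_sums_sparse _ jmono _) _.
  - by move=> i; exact: W_ge0.
  - by move=> i ni; rewrite c0 // c'0 //; exact: W_diag.
  - by apply: eq_bounded_sums => k; rewrite cj c'j.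
have [[c c0 Wc]|nc] := pselect (exists2 c : R, 0 < c &
    forall n, exists2 j, (n <= j)%N & c <= W j 0%N (2 ^ L j)%N).
- have [m [Mm Gm Fm]] :=
    summable_nonsummable fB (fun m => g_ge0 _ (itv01_half_powW m)) small.
  (* Requiring [m k <= j k] gives [m k <= L (j k)], so the grid at coordinate [L (j k)] contains the
     multiples of [2 ^- m k]. *)
  have [|j [jmono jP]] := @increasing_choice
      (fun k j => (m k <= j)%N /\ c <= W j 0%N (2 ^ L j)%N).
    move=> k n; have [j nj cj] := Wc (maxn n (m k)).
    by exists j; rewrite ?(leq_trans _ nj) ?leq_maxl ?leq_maxr //; split;
      rewrite // (leq_trans _ nj) ?leq_maxr.
  have mL k : (m k <= L (j k))%N.
    by apply: leq_trans (strict_leq_id Lmono _); case: (jP k).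
  (* One step of length [2 ^- m k] consists of [e k] units of the grid at [L (j k)]. *)
  pose e k := (2 ^ (L (j k) - m k))%N.
  have me k : (2 ^ m k * e k)%N = (2 ^ L (j k))%N by rewrite -expnD subnKC.
  set K := eps * (1 / 2) `^ alpha.
  have /choice[i iP] : forall k, exists i, (i < 2 ^ m k)%N /\
      K * f (1 / 2 ^+ m k) * c <= W (j k) (i * e k)%N (i.+1 * e k)%N.
    move=> k; have [_ cW] := jP k.
    have [||i im iW] := @subdivision R alpha eps c phi f (m k) (N (j k)) (N (j k).+1)
      (fun i n => v (j k) (i * e k)%N n) alpha_ge1 eps0 phi_ge0 f_def (A1 _ (Mm k)).
    - by move=> i n; apply: v01.
    - by rewrite me mul0n.
    - by exists i.
  have addk := addW j (fun k => i k * e k)%N (fun k => (i k).+1 * e k)%N jmono.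
  have gW : bounded_sums (fun k => W (j k) (i k * e k)%N ((i k).+1 * e k)%N).
    apply/addk => [k|k|].
    + by rewrite -me leq_mul2r; case: (iP k) => /ltnW -> _; rewrite orbT.
    + by rewrite -me leq_mul2r; case: (iP k) => -> _; rewrite orbT.
    + apply: bounded_sums_le Gm => k.
      rewrite (_ : `|_| / _ = 1 / 2 ^+ m k) //.
      rewrite -natrB ?leq_mul2r ?leqnSn ?orbT // -mulnBl subSnn mul1n.
      rewrite ger0_norm // -[in 2 ^+ L _](subnKC (mL k)) exprD invfM /e natrX.
      by rewrite mulrCA divff ?mulr1 ?div1r // expf_neq0.
  (* The chosen steps have bounded [W]-sums because their [g]-sums are bounded; dividing by [K * c]
     bounds the [f]-sums too, against [Fm]. *)
  apply: Fm; have K0 : 0 < K * c by rewrite !mulr_gt0 // powR_gt0.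
  have [B' B'P] := gW; exists (B' / (K * c)) => n.
  rewrite ler_pdivlMr // mulr_suml; apply: le_trans (B'P n); apply: ler_sum => k _.
  by have [_ iW] := iP k; rewrite mulrC mulrAC.
- have [|j [jmono jP]] := @increasing_choice (fun k j => W j 0%N (2 ^ L j)%N <= 2 ^- k).
    move=> k n; apply: contrapT => nj; apply: nc; exists (2 ^- k).
      by rewrite invr_gt0 exprn_gt0.
    move=> n'; exists (maxn n n'); rewrite ?leq_maxr //.
    rewrite leNgt; apply/negP => /ltW h.
    by apply: nj; exists (maxn n n'); rewrite ?leq_maxl.
  (* The numerators 0 and [2 ^ L (j k)] encode the inputs 0 and 1, so every term of the bounded
     [g]-series equals [g 1 > 0]. *)
  have := (addW j (fun=> 0%N) (fun k => 2 ^ L (j k))%N jmono _ _).2.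
  move=> /(_ (fun=> leq0n _) (fun=> leqnn _) (bounded_sums_geometric jP))[B' B'P].
  have g1 : 0 < g 1.
    by rewrite g_def ?ler01 ?lexx // powR1 mul1r psi_gt0 // ltr01 lexx.
  have g1P n : g 1 *+ n <= B'.
    apply: le_trans (B'P n); rewrite -[X in _ *+ X]subn0 -sumr_const_nat.
    apply: ler_sum => k _; rewrite subr0 ger0_norm // natrX divff // expf_neq0.
  have := g1P (Num.bound (B' / g 1)); rewrite leNgt => /negP; apply.
  rewrite -mulr_natr mulrC -ltr_pdivrMr //.
  apply: le_lt_trans (archi_boundP _); first by [].
  by rewrite divr_ge0 ?(ltW g1) //; have := g1P 0%N.
Qed.
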